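(* Let $A=(A_{ij})\in\mathbb{R}^{m\times n}$ and $b=\mathrm{col}(b_1,\dots,b_m)\in\mathbb{R}^m$, and let $b_{ij}\in\mathbb{R}$ be scalars with $b_i=\sum_{j=1}^n b_{ij}$ for $i=1,\dots,m$. Suppose that for every $i\in\{1,\dots,m\}$ the row graph $\mathcal{G}^R_i$ and for every $j\in\{1,\dots,n\}$ the column graph $\mathcal{G}^c_j$ are undirected and connected. Consider the dynamics, for all $i\in\{1,\dots,m\}$, $j\in\{1,\dots,n\}$ and $t\ge 0$, $$\dot x_{ij}=-\Big(A_{ij}y_{ij}-\sum_{kj\in\mathcal{N}^c_{ij}}(z_{ij}-z_{kj})\Big)-\sum_{kj\in\mathcal{N}^c_{ij}}(x_{ij}-x_{kj}),$$ $$\dot\xi_{ij}=-\sum_{ik\in\mathcal{N}^R_{ij}}(y_{ij}-y_{ik}),\qquad y_{ij}=\xi_{ij}+A_{ij}x_{ij}-b_{ij},$$ $$\dot z_{ij}=A_{ij}y_{ij}-\sum_{kj\in\mathcal{N}^c_{ij}}(z_{ij}-z_{kj}),$$ with scalar states $x_{ij},\xi_{ij},z_{ij}\in\mathbb{R}$, initial values $\xi_{ij}(0)=0$ for all $i,j$, and arbitrary initial values $x_{ij}(0),z_{ij}(0)$. Then every $x_{ij}(t)$ converges exponentially, as $t\to\infty$, to a constant $x^*_{ij}\in\mathbb{R}$, and these constants satisfy: (i) $x^*_{1j}=x^*_{2j}=\dots=x^*_{mj}=:x^*_j$ for every $j\in\{1,\dots,n\}$; (ii) $\sum_{i=1}^m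 A_{ij}\sum_{k=1}^n (A_{ik}x^*_k-b_{ik})=0$ for every $j\in\{1,\dots,n\}$; so that $x^*=\mathrm{col}(x^*_1,\dots,x^*_n)$ is a least square solution of $Ax=b$. Moreover, $x^*$ is an exact solution of $Ax=b$ (i.e. $Ax^*=b$) if and only if $\lim_{t\to\infty}y_{ij}(t)=0$ for all $i\in\{1,\dots,m\}$, $j\in\{1,\dots,n\}$.
   Context: There are $mn$ agents labelled $ij$, $i\in\{1,\dots,m\}$, $j\in\{1,\dots,n\}$. For each $i$, $\mathcal{G}^R_i$ is a graph on the vertex set $\{i1,\dots,in\}$ (the agents of row $i$), and $\mathcal{N}^R_{ij}$ is the set of neighbors $ik$ of $ij$ in $\mathcal{G}^R_i$. For each $j$, $\mathcal{G}^c_j$ is a graph on the vertex set $\{1j,\dots,mj\}$ (the agents of column $j$), and $\mathcal{N}^c_{ij}$ is the set of neighbors $kj$ of $ij$ in $\mathcal{G}^c_j$. Edges are unweighted. $\mathrm{col}(\cdot)$ denotes the column stack. A least square solution of $Ax=b$ is a minimizer of $\|Ax-b\|^2$ over $x\in\mathbb{R}^n$ (Euclidean norm), equivalently a vector $x^*$ with $A^T(Ax^*-b)=0$. ''$x(t)$ converges exponentially to $x^*$'' means that there exist constants $C\ge 0$ and $\alpha>0$ with $\|x(t)-x^*\|\le Ce^{-\alpha t}$ for all $t\ge0$. The limits may depend on the initial values. *)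

(* Defs.v *)
From mathcomp Require Import all_boot all_order all_algebra.
From mathcomp Require Import all_classical all_reals all_analysis.

Set Implicit Arguments.
Unset Strict Implicit.
Unset Printing Implicit Defensive.

Import Order.TTheory GRing.Theory Num.Theory.
Import numFieldNormedType.Exports.
Local Open Scope classical_set_scope.
Local Open Scope ring_scope.

Definition undirected_graph (V : finType) (E : rel V) : Prop := symmetric E.

Definition connected_graph (V : finType) (E : rel V) : Prop :=
  forall u v : V, connect E u v.

(* The increment h is restricted to t + h >= 0, so that, for functions of time
   on [0, +oo[, this is the two-sided derivative for t > 0 and the right
   derivative at t = 0; values of f at negative times are irrelevant. *)
Definition has_time_derivative (R : realType) (f : R -> R) (t l : R) : Prop :=
  h^-1 * (f (t + h) - f t) @[h --> within [set h | 0 <= t + h] (0 : R)^'] --> l.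

Definition converges_exponentially (R : realType) (f : R -> R) (l : R) : Prop :=
  exists C alpha : R, [/\ 0 <= C, 0 < alpha &
    forall t : R, 0 <= t -> `|f t - l| <= C * expR (- alpha * t)].

(* Euclidean norm: the library norm on matrices is the sup norm. *)
Definition norm2 (R : realType) (m : nat) (v : 'cV[R]_m) : R :=
  Num.sqrt (\sum_(i < m) v i 0 ^+ 2).

Definition least_square_solution (R : realType) (m n : nat)
    (A : 'M[R]_(m, n)) (b : 'cV[R]_m) (x : 'cV[R]_n) : Prop :=
  forall w : 'cV[R]_n, norm2 (A *m x - b) ^+ 2 <= norm2 (A *m w - b) ^+ 2.

(* Main.v *)
(** Write L1, L2 for the Laplacians of the column and row graphs on the set of
    agents and D for multiplication by A_ij. With a = x', q = L1 x and
    s = y' = D a - L2 y, the form V = |a|^2 + |q|^2 + <y, L2 y> satisfies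
    V' = - 4 <a, L1 a> - 2 |s|^2. Adding a small multiple of <a, q>, whose
    derivative contains - <q, L1 q>, gives W with W' <= - c W: indeed q lies in
    the range of L1, and V is bounded by <a, L1 a> + |s|^2 + |q|^2, because
    L1 a = 0, s = 0 and q = 0 force |a|^2 = - <y, D a> = - <y, L2 y> <= 0.
    Hence a and s decay exponentially, x and y converge, and the limits satisfy
    L1 x = 0, L2 y = 0; so y is constant along each row, with sum the residual
    of that row since the row sums of xi stay 0, while a -> 0 summed over a
    column gives the normal equations. *)

From HB Require Import structures.
Require Import Defs.
From mathcomp Require Import all_boot all_order all_algebra.
From mathcomp Require Import all_classical all_reals all_analysis.
From mathcomp Require Import ring lra.

Set Implicit Arguments.
Unset Strict Implicit.
Unset Printing Implicit Defensive.

Import Order.TTheory GRing.Theory Num.Theory.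
Import numFieldNormedType.Exports.
Local Open Scope classical_set_scope.
Local Open Scope ring_scope.

(** * Functions of time *)

(** Continuing [f] to negative times along its tangent line at 0 turns the one-sided derivative at 0
    into a two-sided one, so that the usual calculus applies on all of t >= 0. *)
Lemma has_time_derivative_extension (R : realType) (f df : R -> R) :
  (forall t : R, 0 <= t -> has_time_derivative f t (df t)) ->
  exists g : R -> R, forall t : R, 0 <= t -> g t = f t /\ is_derive t 1 g (df t).
Proof.
move=> fdf; pose g (t : R) := if 0 <= t then f t else f 0 + df 0 * t.
exists g => t t0; split; first by rewrite /g t0.
have gdf : h^-1 *: ((g \o shift t) (h *: 1) - g t) @[h --> (0 : R)^'] --> df t.
  apply/cvgrPdist_lt => e e0.
  have /cvgrPdist_lt/(_ _ e0) := fdf t t0.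
  rewrite /within/= => near_f.
  (* For t > 0 small increments keep t + h nonnegative; at t = 0 both signs of h must be treated. *)
  have near_t : \forall h \near (0 : R)^', (0 < t -> 0 <= t + h) /\ h != 0.
    have [t_gt0|t_le0] := ltP 0 t; last first.
      by near=> h; split=> //; near: h; exact: nbhs_dnbhs_neq.
    near=> h; split; last by near: h; exact: nbhs_dnbhs_neq.
    move=> _; rewrite -lerBlDl sub0r.
    have : `|h| < t by near: h; exact: dnbhs0_lt.
    by rewrite ltr_norml => /andP[/ltW].
  near=> h.
  have [th0 hn0] : (0 < t -> 0 <= t + h) /\ h != 0 by near: h.
  have fh : 0 <= t + h -> `|df t - h^-1 * (f (t + h) - f t)| < e by near: h.
  rewrite /= /g t0 /GRing.scale /= mulr1 (addrC h t).
  case: ifPn => // /negP th_lt0.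
  (* The linear branch is reached only from t = 0, and there the difference quotient equals [df 0]
     exactly. *)
  have t_eq0 : t = 0.
    by move: t0; rewrite le_eqVlt => /predU1P[//|/th0].
  rewrite t_eq0 add0r (addrC (f 0)) addrK mulrC mulfK// subrr normr0//.
apply: DeriveDef; first by apply/cvg_ex; exists (df t).
exact: (cvg_lim _ gdf).
Unshelve. all: by end_near. Qed.

Section time_functions.
Variable R : realType.
Implicit Types f g df dg : R -> R.

Lemma is_derive_ge0_nincr f df :
  (forall t : R, 0 <= t -> is_derive t 1 f (df t)) ->
  (forall t : R, 0 <= t -> df t <= 0) ->
  forall s t, 0 <= s -> s <= t -> f t <= f s.
Proof.
move=> fdf df0 s t s0 st.
have fs u : u \in `[s, t] -> 0 <= u.
  by rewrite in_itv/= => /andP[+ _]; exact: le_trans.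
have [||c cst fst] := @MVT_segment _ f df s t st.
- by move=> u /subset_itv_oo_cc/fs; exact: fdf.
- apply: derivable_within_continuous => u /fs u0.
  by have [] := fdf u u0.
- rewrite -subr_le0 fst mulr_le0_ge0 ?subr_ge0//.
  exact/df0/fs.
Qed.

Lemma is_derive_bigsum (I : finType) (P : pred I) (f df : I -> R -> R) (t : R) :
  (forall i, is_derive t 1 (f i) (df i t)) ->
  is_derive t 1 (fun t => \sum_(i | P i) f i t) (\sum_(i | P i) df i t).
Proof.
move=> fdf.
have -> : (fun t => \sum_(i | P i) f i t) = \sum_(i | P i) f i.
  by apply/funext => s; rewrite fct_sumE.
elim/big_ind2 : _ => [|f1 g1 f2 g2 ? ?|i _]; last exact: fdf.
- exact: is_derive_cst.
- exact: is_deriveD.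
Qed.

Lemma is_derive_mul f g (df dg t : R) :
  is_derive t 1 f df -> is_derive t 1 g dg ->
  is_derive t 1 (fun t => f t * g t) (df * g t + f t * dg).
Proof.
move=> fdf gdg; apply: is_derive_eq; rewrite addrC.
by congr (_ + _); rewrite /GRing.scale/= mulrC.
Qed.

Lemma is_derive_scale (c : R) f (df t : R) :
  is_derive t 1 f df -> is_derive t 1 (fun t => c * f t) (c * df).
Proof.
move=> fdf; apply: is_derive_eq (is_derive_mul (is_derive_cst c t 1) fdf) _.
by rewrite mul0r add0r.
Qed.

Lemma is_derive_expRM (c t : R) :
  is_derive t 1 (fun t => expR (c * t)) (c * expR (c * t)).
Proof.
have ct : is_derive t 1 (fun t => c * t) c.
  by apply: is_derive_eq (is_derive_scale c (is_derive_id t 1)) _; rewrite mulr1.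
apply: is_derive_eq (is_derive1_comp (is_derive_expR (c * t)) ct) _.
by rewrite mulrC.
Qed.

(** The product [f t * expR (c * t)] has nonpositive derivative, hence stays below its value at
    0. *)
Lemma gronwall f df (c : R) :
  (forall t : R, 0 <= t -> is_derive t 1 f (df t)) ->
  (forall t : R, 0 <= t -> df t <= - c * f t) ->
  forall t : R, 0 <= t -> f t <= f 0 * expR (- c * t).
Proof.
move=> fdf dfle t t0.
have fe (s : R) : 0 <= s -> is_derive s 1 (fun s => f s * expR (c * s))
    (df s * expR (c * s) + f s * (c * expR (c * s))).
  by move=> s0; apply: is_derive_mul (fdf s s0) (is_derive_expRM c s).
have := is_derive_ge0_nincr fe _ (lexx 0) t0.
rewrite mulr0 expR0 mulr1 mulNr expRN ler_pdivlMr ?expR_gt0//; apply => s s0.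
rewrite mulrA -mulrDl pmulr_lle0 ?expR_gt0//.
by have := dfle s s0; rewrite mulNr (mulrC c); lra.
Qed.

(* With primitives [g t = C / alpha * expR (- alpha * t)] of the bound, f + g
   decreases and f - g increases, so that they enclose a common limit. *)
Lemma derive_exp_bound_converges f df (C alpha : R) :
  0 <= C -> 0 < alpha ->
  (forall t : R, 0 <= t -> is_derive t 1 f (df t)) ->
  (forall t : R, 0 <= t -> `|df t| <= C * expR (- alpha * t)) ->
  exists l, converges_exponentially f l.
Proof.
move=> C0 a0 fdf dfle.
pose g (t : R) := C / alpha * expR (- alpha * t).
have gdg (t : R) : is_derive t 1 g (- (C * expR (- alpha * t))).
  apply: is_derive_eq (is_derive_scale _ (is_derive_expRM _ _)) _.
  by rewrite mulNr mulrN mulrA divfK// gt_eqF.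
have g0 t : 0 <= g t by rewrite mulr_ge0 ?divr_ge0 ?expR_ge0// ltW.
have upper : forall s t, 0 <= s -> s <= t -> f t + g t <= f s + g s.
  apply: (is_derive_ge0_nincr (df := fun t => df t - C * expR (- alpha * t))).
    by move=> t t0; apply: is_deriveD; exact: fdf.
  by move=> t t0; rewrite subr_le0 (le_trans (ler_norm _))// dfle.
have lower s t : 0 <= s -> s <= t -> f s - g s <= f t - g t.
  move=> s0 st; rewrite -lerN2 !opprB; move: s t s0 st.
  apply: (is_derive_ge0_nincr (df := fun t => - (C * expR (- alpha * t)) - df t)).
    by move=> t t0; apply: is_deriveB; exact: fdf.
  move=> t t0; rewrite -opprD oppr_le0 addrC -lerBlDr sub0r.
  by have /ler_normlP[+ _] := dfle t t0; rewrite lerNl.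
have lu s t : 0 <= s -> 0 <= t -> f s - g s <= f t + g t.
  move=> s0 t0; have [st|/ltW ts] := leP s t.
  - apply: (le_trans (lower _ _ s0 st)); rewrite lerD2l.
    by rewrite (le_trans _ (g0 t))// oppr_le0.
  - apply: le_trans (upper _ _ t0 ts); rewrite lerD2l.
    by rewrite (le_trans _ (g0 s))// oppr_le0.
(* The limit is the supremum of the lower envelope [f - g]. It lies between the envelopes at every
   time, so its distance to [f t] is at most [g t]. *)
pose S := [set f s - g s | s in [set s | 0 <= s]].
have S0 : S (f 0 - g 0) by exists 0 => //=.
have Sub t : 0 <= t -> ubound S (f t + g t).
  by move=> t0 _ [s s0 <-]; exact: lu.
exists (sup S); exists (C / alpha), alpha; split => //.
  by rewrite divr_ge0// ltW.
move=> t t0; rewrite ler_distl -/(g t).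
apply/andP; split.
  by rewrite lerBlDr; apply: ge_sup; [exists (f 0 - g 0)|exact: Sub].
rewrite -lerBlDr; apply: ub_le_sup; last by exists t.
by exists (f 0 + g 0); exact: Sub.
Qed.

Lemma converges_exponentially_cvg f (l : R) :
  converges_exponentially f l -> f t @[t --> +oo] --> l.
Proof.
move=> [C [alpha [C0 a0 fl]]].
have e0 : C * expR (- alpha * t) @[t --> +oo] --> (0 : R).
  rewrite -[X in _ --> X](mulr0 C); apply: cvgMr.
  under eq_fun do rewrite mulNr.
  apply: (@cvg_comp _ _ _ (fun t => alpha * t) (fun t => expR (- t)) _ +oo).
    by apply: gt0_cvgMry => //; exact: cvg_id.
  exact: cvgr_expR.
apply/cvgrPdist_lt => e e_gt0.
near=> t; rewrite distrC (le_lt_trans (fl t _))//.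
have : `|0 - C * expR (- alpha * t)| < e.
  by near: t; move/cvgrPdist_lt : e0; exact.
by rewrite sub0r normrN ger0_norm// mulr_ge0// expR_ge0.
Unshelve. all: by end_near. Qed.

End time_functions.

(** * Linear maps on finite-dimensional spaces *)

Section inner_product.
Variables (R : realFieldType) (T : finType).
Implicit Types u v : T -> R.

(** The arguments are plain functions, so that finite functions (by coercion) and rows of
    coefficients can both be paired. *)
Definition dot u v : R := \sum_p u p * v p.

Lemma dotC u v : dot u v = dot v u.
Proof. by apply: eq_bigr => p _; rewrite mulrC. Qed.

Lemma dotDl (u v w : {ffun T -> R^o}) : dot (u + v) w = dot u w + dot v w.
Proof. by rewrite -big_split; apply: eq_bigr => p _; rewrite ffunE mulrDl. Qed.

Lemma dotNl (u v : {ffun T -> R^o}) : dot (- u) v = - dot u v.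
Proof. by rewrite -sumrN; apply: eq_bigr => p _; rewrite ffunE mulNr. Qed.

Lemma dotBl (u v w : {ffun T -> R^o}) : dot (u - v) w = dot u w - dot v w.
Proof. by rewrite dotDl dotNl. Qed.

Lemma dot0l u : dot (0 : {ffun T -> R^o}) u = 0.
Proof. by rewrite /dot big1// => p _; rewrite ffunE mul0r. Qed.

Lemma dot_ge0 u : 0 <= dot u u.
Proof. by apply: sumr_ge0 => p _; rewrite -expr2 sqr_ge0. Qed.

Lemma dot_eq0 u : dot u u = 0 -> forall p, u p = 0.
Proof.
move=> /eqP; rewrite psumr_eq0 => [/allP u0 p|p _]; last first.
  by rewrite -expr2 sqr_ge0.
by apply/eqP; have := u0 p (mem_index_enum p); rewrite mulf_eq0 orbb.
Qed.

Lemma sqr_le_dot u p : u p ^+ 2 <= dot u u.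
Proof.
rewrite /dot (bigD1 p)//= -expr2 lerDl.
by apply: sumr_ge0 => q _; rewrite -expr2 sqr_ge0.
Qed.

(** Lagrange's identity: the sum over all p, q of the squares of u_p v_q - u_q v_p is twice the
    difference of the two sides. *)
Lemma cauchy_schwarz u v : dot u v ^+ 2 <= dot u u * dot v v.
Proof.
have : 0 <= \sum_p \sum_q (u p * v q - u q * v p) ^+ 2.
  by apply: sumr_ge0 => p _; apply: sumr_ge0 => q _; rewrite sqr_ge0.
suff -> : \sum_p \sum_q (u p * v q - u q * v p) ^+ 2 =
    (dot u u * dot v v - dot u v ^+ 2) *+ 2.
  by rewrite pmulrn_lge0// subr_ge0.
have E (a b : T -> R) : dot a a * dot b b = \sum_p \sum_q (a p * b q) ^+ 2.
  rewrite big_distrl; apply: eq_bigr => p _; rewrite big_distrr.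
  by apply: eq_bigr => q _ /=; ring.
rewrite mulr2n {1}E [X in _ = _ + (X - _)]mulrC E expr2.
rewrite big_distrl -!sumrB -big_split; apply: eq_bigr => p _ /=.
rewrite big_distrr -!sumrB -big_split; apply: eq_bigr => q _ /=.
ring.
Qed.

(** Expand the nonnegative quantities |c u + v|^2 / c and |c u - v|^2 / c. *)
Lemma young u v c : 0 < c ->
  `|2 * dot u v| <= c * dot u u + c^-1 * dot v v.
Proof.
move=> c0; rewrite ler_norml lerNl; apply/andP; split.
- have : 0 <= \sum_p c^-1 * (c * u p + v p) ^+ 2.
    by apply: sumr_ge0 => p _; rewrite mulr_ge0 ?sqr_ge0// invr_ge0 ltW.
  rewrite -[- _ <= _]subr_ge0; congr (_ <= _).
  rewrite opprK /dot !big_distrr -!big_split; apply: eq_bigr => p _ /=.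
  by field; rewrite gt_eqF.
- have : 0 <= \sum_p c^-1 * (c * u p - v p) ^+ 2.
    by apply: sumr_ge0 => p _; rewrite mulr_ge0 ?sqr_ge0// invr_ge0 ltW.
  rewrite -[2 * dot u v <= _]subr_ge0; congr (_ <= _).
  rewrite /dot !big_distrr -big_split -sumrB; apply: eq_bigr => p _ /=.
  by field; rewrite gt_eqF.
Qed.

End inner_product.

(** * Bounds for linear maps and factorization through a kernel *)

Section linear_bound.
Variable R : realFieldType.

Lemma linear_ffunE (I J : finType) (f : {linear {ffun I -> R^o} -> {ffun J -> R^o}})
    (u : {ffun I -> R^o}) j :
  f u j = dot u (fun i => f [ffun k => (k == i)%:R] j).
Proof.
have {1}-> : u = \sum_i (u i : R) *: ([ffun k => (k == i)%:R] : {ffun I -> R^o}).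
  apply/ffunP => k; rewrite sum_ffunE (bigD1 k)//= !ffunE eqxx.
  rewrite big1 => [|i ik]; last by rewrite !ffunE eq_sym (negbTE ik) scaler0.
  by rewrite addr0 [RHS]mulr1.
rewrite linear_sum sum_ffunE; apply: eq_bigr => i _.
by rewrite linearZ !ffunE.
Qed.

(** Cauchy-Schwarz on each row of the matrix of [f] gives the squared Frobenius norm as a bound; the
    added 1 keeps the constant positive when [f] is zero. *)
Lemma linear_bounded (I J : finType) (f : {linear {ffun I -> R^o} -> {ffun J -> R^o}}) :
  exists2 C : R, 0 < C & forall u, dot (f u) (f u) <= C * dot u u.
Proof.
pose c j i := f [ffun k => (k == i)%:R] j : R.
exists (1 + \sum_j dot (c j) (c j)).
  by rewrite ltr_pwDl// sumr_ge0// => j _; exact: dot_ge0.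
move=> u; rewrite mulrDl mul1r ler_wpDl ?dot_ge0//.
rewrite mulr_suml; apply: ler_sum => j _.
by rewrite -expr2 linear_ffunE mulrC cauchy_schwarz.
Qed.

(** A map that vanishes on the kernel of [f] factors as [h] after [f], with [h] built from a
    generalized inverse of [f], and [h] is bounded. This turns purely algebraic kernel inclusions
    into quantitative estimates, without compactness or eigenvalues. *)
Lemma linear_kernel_bound (vT : vectType R) (I J : finType)
    (f : {linear vT -> {ffun I -> R^o}}) (g : {linear vT -> {ffun J -> R^o}}) :
  (forall v, f v = 0 -> g v = 0) ->
  exists2 C : R, 0 < C & forall v, dot (g v) (g v) <= C * dot (f v) (f v).
Proof.
move=> fg; pose h := (linfun g \o (linfun f)^-1)%VF.
have gE v : g v = h (f v).
  apply/eqP; rewrite comp_lfunE lfunE -subr_eq0 -linearB; apply/eqP/fg.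
  rewrite linearB /= -[X in _ - X]lfunE limg_lfunVK ?subrr//.
  by rewrite -(lfunE f) memv_img// memvf.
have [C C0 hC] := linear_bounded h.
by exists C => // v; rewrite gE hC.
Qed.

End linear_bound.

(** * Positive semidefinite self-adjoint operators *)

Section self_adjoint.
Variables (R : realFieldType) (T : finType).
Local Notation U := {ffun T -> R^o}.

Definition self_adjoint (L : U -> U) :=
  forall u v : U, dot (L u) v = dot u (L v).

Variables (L : {linear U -> U}) (k : R).
Hypotheses (Lsym : self_adjoint L) (k_gt0 : 0 < k).
(** This single inequality carries both the positivity of the quadratic form of [L] and the fact
    that the zeros of the form lie in the kernel of [L]. *)
Hypothesis Lk : forall u : U, dot (L u) (L u) <= k * dot u (L u).

Lemma form_ge0 (u : U) : 0 <= dot u (L u).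
Proof. by rewrite -(pmulr_rge0 _ k_gt0) (le_trans (dot_ge0 _) (Lk u)). Qed.

Lemma form_eq0 (u : U) : dot u (L u) = 0 -> L u = 0.
Proof.
move=> u0; apply/ffunP => p; rewrite ffunE.
apply: (@dot_eq0 _ _ (L u)); apply/eqP; rewrite eq_le dot_ge0 andbT.
by rewrite (le_trans (Lk u))// u0 mulr0.
Qed.

(** A spectral gap on the range of [L]. By self-adjointness L L u = 0 forces L u = 0, so |L u|^2 <=
    C |L L u|^2, and [Lk] applied to L u bounds this by C k <L u, L L u>. *)
Lemma form_gap_range : exists2 mu : R, 0 < mu &
  forall u : U, mu * dot (L u) (L u) <= dot (L u) (L (L u)).
Proof.
have [|C C0 hC] := @linear_kernel_bound _ _ _ _ (L \o L) L.
  move=> u /= LLu; apply: form_eq0; rewrite -Lsym.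
  have LLu0 : dot (L u) (L u) = 0 by rewrite Lsym LLu dotC dot0l.
  by rewrite dotC /dot big1// => p _; rewrite (dot_eq0 LLu0) mulr0.
exists (C * k)^-1; first by rewrite invr_gt0 mulr_gt0.
move=> u; rewrite ler_pdivrMl ?mulr_gt0// (le_trans (hC u))//= -mulrA.
by rewrite ler_pM2l.
Qed.

(* With K an inverse of L on its range, [dot u (L u) = dot (L u) (K (L u))]. *)
Lemma form_le_range : exists2 C : R, 0 < C &
  forall u : U, dot u (L u) <= C * dot (L u) (L u).
Proof.
pose K : 'End(U) := ((linfun L)^-1)%VF.
have [C C0 hC] := linear_bounded K.
exists (1 + C) => [|u]; first exact: addr_gt0.
have LK : L (K (L u)) = L u.
  by rewrite -!(lfunE L) limg_lfunVK// memv_img// memvf.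
have -> : dot u (L u) = dot (L u) (K (L u)) by rewrite Lsym LK.
have := young (L u) (K (L u)) ltr01; rewrite ler_norml => /andP[_].
have := hC (L u); have := dot_ge0 (L u); have := dot_ge0 (K (L u)).
rewrite invr1; lra.
Qed.

End self_adjoint.

(** * Observability of the linear system *)

Section observability.
Variables (R : realFieldType) (T : finType).
Local Notation U := {ffun T -> R^o}.
Variables (L1 L2 D : {linear U -> U}) (k1 k2 : R).
Hypotheses (L1sym : self_adjoint L1) (L2sym : self_adjoint L2).
Hypotheses (Dsym : self_adjoint D) (k1_gt0 : 0 < k1) (k2_gt0 : 0 < k2).
Hypothesis L1k : forall u : U, dot (L1 u) (L1 u) <= k1 * dot u (L1 u).
Hypothesis L2k : forall u : U, dot (L2 u) (L2 u) <= k2 * dot u (L2 u).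

(** A state is the triple ((x, y), z); [speed] is the velocity a = x' that it determines. *)
Let speed (v : U * U * U) : U := L1 v.2 - D v.1.2 - L1 v.1.1.

Let speed_linear : linear speed.
Proof.
move=> c u v; apply/ffunP => p; rewrite /speed !linearP /= !ffunE /GRing.scale /=.
ring.
Qed.

(** The three dissipated quantities L1 a, s and L1 x are stacked into one vector over three copies
    of [T], so that the kernel bound applies to a single linear map. *)
Let output (v : U * U * U) : {ffun T + T + T -> R^o} := [ffun i => match i with
  | inl (inl p) => L1 (speed v) p
  | inl (inr p) => (D (speed v) - L2 v.1.2) p
  | inr p => L1 v.1.1 p end].

Let output_linear : linear output.
Proof.
move=> c u v; apply/ffunP => -[[p|p]|p]; rewrite !ffunE /=
  ?speed_linear !linearP !ffunE //.
rewrite /GRing.scale /=; ring.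
Qed.

HB.instance Definition _ := GRing.isLinear.Build _ _ _ _ speed speed_linear.
HB.instance Definition _ := GRing.isLinear.Build _ _ _ _ output output_linear.

Lemma output_eq0 v : output v = 0 -> speed v = 0 /\ L2 v.1.2 = 0.
Proof.
case: v => [[x y] z] /ffunP out0; set a := speed _.
have L1a : L1 a = 0 by apply/ffunP => p; have := out0 (inl (inl p)); rewrite !ffunE.
have Da : D a = L2 y.
  apply/eqP; rewrite -subr_eq0; apply/eqP/ffunP => p.
  by have := out0 (inl (inr p)); rewrite !ffunE.
have L1x : L1 x = 0 by apply/ffunP => p; have := out0 (inr p); rewrite !ffunE.
(* In <a, a> the term <L1 z, a> drops since L1 a = 0, the term in L1 x is zero, and moving [D]
   across turns <D y, a> into <y, D a> = <y, L2 y>. *)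
have aa : dot a a = - dot y (L2 y).
  rewrite {1}/a /speed/= L1x subr0 dotBl L1sym L1a Dsym Da.
  by rewrite dotC dot0l sub0r.
have a0 : dot a a = 0.
  by apply/eqP; rewrite eq_le dot_ge0 andbT aa oppr_le0 (form_ge0 k2_gt0 L2k).
split; first by apply/ffunP => p; rewrite [RHS]ffunE; exact: (dot_eq0 a0).
apply: (form_eq0 L2k); rewrite /=.
by apply/eqP; rewrite -oppr_eq0 -aa a0.
Qed.

Lemma observability : exists2 C : R, 0 < C & forall x y z a s : U,
    a = L1 z - D y - L1 x -> s = D a - L2 y ->
  dot a a + dot y (L2 y) <=
    C * (dot a (L1 a) + dot s s + dot (L1 x) (L1 x)).
Proof.
have [C1 C1_gt0 hC1] := @linear_kernel_bound _ _ _ _ output speed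
  (fun v v0 => (output_eq0 v0).1).
pose L2y (v : U * U * U) : U := L2 v.1.2.
have L2y_linear : linear L2y by move=> c u v; rewrite /L2y !linearP.
pose L2yl : {linear _ -> _} := HB.pack L2y (GRing.isLinear.Build _ _ _ _ L2y L2y_linear).
have [C2 C2_gt0 hC2] := @linear_kernel_bound _ _ _ _ output L2yl
  (fun v v0 => (output_eq0 v0).2).
have [C3 C3_gt0 hC3] := form_le_range L2sym.
exists ((C1 + C3 * C2) * (1 + k1)) => [|x y z _ _ -> ->].
  by rewrite mulr_gt0// addr_gt0 ?mulr_gt0.
set a := L1 z - _ - _; set s := D a - _.
have outE : dot (output (x, y, z)) (output (x, y, z)) =
    dot (L1 a) (L1 a) + dot s s + dot (L1 x) (L1 x).
  rewrite {1}/dot !big_sumType /=.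
  by congr (_ + _ + _); apply: eq_bigr => p _; rewrite !ffunE.
have le1 : dot a a + dot y (L2 y) <=
    (C1 + C3 * C2) * dot (output (x, y, z)) (output (x, y, z)).
  rewrite mulrDl lerD ?(hC1 (x, y, z))// -mulrA.
  by rewrite (le_trans (hC3 y))// ler_pM2l// (hC2 (x, y, z)).
apply: (le_trans le1); rewrite -mulrA ler_pM2l ?addr_gt0 ?mulr_gt0// outE.
have := L1k a; have := form_ge0 k1_gt0 L1k a.
have := mulr_ge0 (ltW k1_gt0) (dot_ge0 s).
have := mulr_ge0 (ltW k1_gt0) (dot_ge0 (L1 x)).
lra.
Qed.

End observability.

(** * The closed loop *)

Section vector_signals.
Variables (R : realType) (T : finType).
Local Notation U := {ffun T -> R^o}.
Implicit Types (u v du dv : R -> U) (t : R).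

(** Componentwise differentiation reduces everything to real-valued functions of time. *)
Definition vderive u du t :=
  forall p, is_derive t 1 (fun t => u t p : R) (du t p : R).

Lemma vderive_cst (c : U) t : vderive (fun=> c) (fun=> 0) t.
Proof. by move=> p; rewrite ffunE; exact: is_derive_cst. Qed.

Lemma vderiveB u v du dv t : vderive u du t -> vderive v dv t ->
  vderive (fun t => u t - v t) (fun t => du t - dv t) t.
Proof.
move=> udu vdv p.
have -> : (fun t => (u t - v t) p) = (fun t => u t p : R) - (fun t => v t p : R).
  by apply/funext => s; rewrite !ffunE.
by rewrite !ffunE; exact: is_deriveB (udu p) (vdv p).
Qed.

Lemma vderive_linear (L : {linear U -> U}) u du t : vderive u du t ->
  vderive (fun t => L (u t)) (fun t => L (du t)) t.
Proof.
move=> udu p; pose c q := L [ffun k => (k == q)%:R] p : R.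
have -> : (fun t => L (u t) p) = (fun t => \sum_q c q * u t q).
  apply/funext => s; rewrite linear_ffunE.
  by apply: eq_bigr => q _; rewrite mulrC.
have -> : L (du t) p = \sum_q c q * du t q.
  by rewrite linear_ffunE; apply: eq_bigr => q _; rewrite mulrC.
by apply: (is_derive_bigsum _ (df := fun q t => c q * du t q)) => q;
  apply: is_derive_scale; exact: udu.
Qed.

Lemma is_derive_dot u v du dv t : vderive u du t -> vderive v dv t ->
  is_derive t 1 (fun t => dot (u t) (v t)) (dot (du t) (v t) + dot (u t) (dv t)).
Proof.
move=> udu vdv; rewrite /dot -big_split /=.
apply: (is_derive_bigsum _
  (df := fun q t => (du t q : R) * v t q + (u t q : R) * dv t q)) => q.
exact: is_derive_mul (udu q) (vdv q).
Qed.

Lemma cvg_linear (L : {linear U -> U}) u (l : U) (F : set_system R)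
    {FF : Filter F} : (forall p, u t p @[t --> F] --> (l p : R)) ->
  forall p, L (u t) p @[t --> F] --> (L l p : R).
Proof.
move=> ul p; pose c q := L [ffun k => (k == q)%:R] p : R.
have -> : (fun t => L (u t) p) = (fun t => \sum_q (u t q : R) * c q).
  by apply/funext => s; rewrite linear_ffunE.
rewrite linear_ffunE /dot.
apply: cvg_big => [|q _]; first exact: add_continuous.
by apply: cvgM; [exact: ul|exact: cvg_cst].
Qed.

End vector_signals.

(** Passing from a quadratic bound to a single component takes a square root, which halves the
    rate. *)
Lemma sqr_le_expR (R : realType) (f C alpha t : R) : 0 <= C ->
  f ^+ 2 <= C * expR (- alpha * t) ->
  `|f| <= Num.sqrt C * expR (- (alpha / 2) * t).
Proof.
move=> C0 fC; rewrite -ler_sqr ?nnegrE ?mulr_ge0 ?sqrtr_ge0 ?expR_ge0//.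
rewrite real_normK ?num_real// exprMn sqr_sqrtr// -expRM_natl.
by apply: (le_trans fC); rewrite ler_wpM2l// ler_expR; lra.
Qed.

(** * Lyapunov decay and convergence of the closed loop *)

Section closed_loop.
Variables (R : realType) (T : finType).
Local Notation U := {ffun T -> R^o}.
Variables (L1 L2 D : {linear U -> U}) (k1 k2 : R).
Hypotheses (L1sym : self_adjoint L1) (L2sym : self_adjoint L2).
Hypotheses (Dsym : self_adjoint D) (k1_gt0 : 0 < k1) (k2_gt0 : 0 < k2).
Hypothesis L1k : forall u : U, dot (L1 u) (L1 u) <= k1 * dot u (L1 u).
Hypothesis L2k : forall u : U, dot (L2 u) (L2 u) <= k2 * dot u (L2 u).
Variables x y z : R -> U.
Let a t := L1 (z t) - D (y t) - L1 (x t).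
Let s t := D (a t) - L2 (y t).
Let q t := L1 (x t).
Hypothesis dx : forall t : R, 0 <= t -> vderive x a t.
(** The state xi is eliminated: differentiating y = xi + D x - b gives y' = D a - L2 y. *)
Hypothesis dy : forall t : R, 0 <= t -> vderive y s t.
Hypothesis dz : forall t : R, 0 <= t -> vderive z (fun t => D (y t) - L1 (z t)) t.

Let a' t := L1 (D (y t) - L1 (z t)) - D (s t) - L1 (a t).

Let da (t : R) : 0 <= t -> vderive a a' t.
Proof.
move=> t0; apply: vderiveB; last exact/vderive_linear/dx.
apply: vderiveB; last exact/vderive_linear/dy.
exact/vderive_linear/dz.
Qed.

(** Since z' = D y - L1 z = - (a + q), the acceleration depends only on a, q and s. *)
Let a'E t : a' t = - L1 (a t) - L1 (q t) - D (s t) - L1 (a t).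
Proof.
rewrite /a'; congr (_ - _ - _).
rewrite -opprD -(linearD L1) -[RHS](linearN L1); congr (L1 _).
by rewrite /a /q subrK opprB.
Qed.

Let dot_a' t (u : U) : dot (a' t) u =
  - 2 * dot (L1 (a t)) u - dot (L1 (q t)) u - dot (D (s t)) u.
Proof. by rewrite a'E 3!dotBl dotNl; ring. Qed.

Let V t := dot (a t) (a t) + dot (q t) (q t) + dot (y t) (L2 (y t)).

Let dV t := - 4 * dot (a t) (L1 (a t)) - 2 * dot (s t) (s t).

(** The terms in <L1 q, a> coming from |a|^2 and |q|^2 cancel by symmetry of [L1], while - 2 <D s,
    a> + 2 <s, L2 y> combine to - 2 |s|^2. *)
Let V_derive (t : R) : 0 <= t -> is_derive t 1 V (dV t).
Proof.
move=> t0.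
have dq := vderive_linear L1 (dx t0).
have dL2y := vderive_linear L2 (dy t0).
have := is_deriveD (is_deriveD (is_derive_dot (da t0) (da t0))
  (is_derive_dot dq dq)) (is_derive_dot (dy t0) dL2y).
move=> /is_derive_eq; apply.
have hy : dot (y t) (L2 (s t)) = dot (s t) (L2 (y t)) by rewrite dotC L2sym.
have hq : dot (L1 (q t)) (a t) = dot (L1 (a t)) (q t) by rewrite L1sym dotC.
have hs : dot (s t) (s t) = dot (D (s t)) (a t) - dot (s t) (L2 (y t)).
  by rewrite {1}/s dotBl Dsym dotC [X in _ - X]dotC Dsym.
rewrite (dotC (a t) (a' t)) dot_a' /dV hy hs hq (dotC (q t)) (dotC (a t)).
ring.
Qed.

Let aq_derive (t : R) : 0 <= t -> is_derive t 1 (fun t => dot (a t) (q t))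
  (- 2 * dot (L1 (a t)) (q t) - dot (q t) (L1 (q t)) - dot (D (s t)) (q t)
   + dot (a t) (L1 (a t))).
Proof.
move=> t0.
have := is_derive_dot (da t0) (vderive_linear L1 (dx t0)).
move=> /is_derive_eq; apply.
by rewrite dot_a' (dotC (L1 (q t))); ring.
Qed.

Let V_ge t : [/\ dot (a t) (a t) <= V t, dot (q t) (q t) <= V t &
  dot (y t) (L2 (y t)) <= V t].
Proof.
rewrite /V; have := dot_ge0 (a t); have := dot_ge0 (q t).
by have := form_ge0 k2_gt0 L2k (y t) => *; split; lra.
Qed.

(** The dissipation [dV] contains no term in q; the cross term eps <a, q> supplies one, and eps is
    small enough for W = V + eps <a, q> to stay comparable with V. *)
Let lyapunov : exists eps c : R, [/\ 0 < c,
  forall t, V t <= 2 * (V t + eps * dot (a t) (q t)) &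
  forall t, dV t + eps *
    (- 2 * dot (L1 (a t)) (q t) - dot (q t) (L1 (q t)) - dot (D (s t)) (q t)
     + dot (a t) (L1 (a t))) <= - c * (V t + eps * dot (a t) (q t))].
Proof.
have [mu mu_gt0 hmu] := form_gap_range L1sym k1_gt0 L1k.
have [d d_gt0 hD] := linear_bounded D.
have [C C_gt0 hC] := observability L1sym L2sym Dsym k1_gt0 k2_gt0 L1k L2k.
(* [M] dominates the coefficients of <a, L1 a> and |s|^2 that the cross terms below produce. With
   eps = 1 / M they cost at most one unit of each, out of the 4 and 2 available in [dV]. *)
pose M := 4 / mu * k1 + d / mu + 1.
have M_gt1 : 1 < M.
  by rewrite ltrDr addr_gt0 ?divr_gt0// !mulr_gt0 ?invr_gt0.
pose eps := M^-1.
have eps_gt0 : 0 < eps by rewrite invr_gt0; lra.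
have eps_le1 : eps <= 1 by rewrite invf_le1; lra.
have epsM : eps * M = 1 by rewrite mulVf//; lra.
have em_gt0 : 0 < eps * (mu / 2) by rewrite mulr_gt0// divr_gt0.
(* [c1] is the smaller of the two dissipation rates that remain: 1 for al + S and eps mu / 2 for
   Q. *)
have [c1 [c1_gt0 c1_le1 c1_le]] : exists c1, [/\ 0 < c1, c1 <= 1 & c1 <= eps * (mu / 2)].
  by exists (Num.min 1 (eps * (mu / 2))); rewrite lt_min ltr01 em_gt0 !ge_min !lexx orbT.
have aqV t : `|2 * dot (a t) (q t)| <= V t.
  apply: (le_trans (young (a t) (q t) ltr01)); rewrite /V invr1 !mul1r lerDl.
  exact: form_ge0 L2k _.
have eaqV t : `|2 * (eps * dot (a t) (q t))| <= V t.
  rewrite mulrCA normrM gtr0_norm//; apply: le_trans (aqV t).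
  by rewrite ler_piMl.
(* Observability gives V <= (C + 1) (al + S + Q), the extra 1 accounting for |q|^2 in V; the factor
   2 covers W <= 3/2 V. *)
have c_gt0 : 0 < c1 / (2 * (C + 1)) by rewrite divr_gt0// mulr_gt0// addr_gt0.
exists eps, (c1 / (2 * (C + 1))); split => // [t|t].
  by have := eaqV t; rewrite ler_norml => /andP[]; lra.
set al := dot (a t) (L1 (a t)); set S := dot (s t) (s t); set Q := dot (q t) (q t).
have al0 : 0 <= al := form_ge0 k1_gt0 L1k _.
have S0 : 0 <= S := dot_ge0 _.
have Q0 : 0 <= Q := dot_ge0 _.
(* The Young weights in [cross1] and [cross2] are tuned so that each costs mu / 4 of Q, together
   half of the gap [mu]. *)
have cross1 : - 2 * dot (L1 (a t)) (q t) <= 4 / mu * k1 * al + mu / 4 * Q.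
  have mu4 : 0 < 4 / mu by rewrite divr_gt0.
  have := young (L1 (a t)) (q t) mu4; rewrite ler_norml invf_div => /andP[+ _].
  have : 4 / mu * dot (L1 (a t)) (L1 (a t)) <= 4 / mu * (k1 * al).
    by rewrite ler_pM2l// L1k.
  rewrite -/Q; lra.
have cross2 : - dot (D (s t)) (q t) <= d / mu * S + mu / 4 * Q.
  have mu2 : 0 < 2 / mu by rewrite divr_gt0.
  have := young (D (s t)) (q t) mu2; rewrite ler_norml invf_div => /andP[+ _].
  have : 2 / mu * dot (D (s t)) (D (s t)) <= 2 / mu * (d * S).
    by rewrite ler_pM2l// hD.
  rewrite -/Q.
  have -> : d / mu * S = 2^-1 * (2 / mu * (d * S)) by field; lra.
  lra.
have crossQ : mu * Q <= dot (q t) (L1 (q t)) := hmu (x t).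
have dissip : dV t + eps *
    (- 2 * dot (L1 (a t)) (q t) - dot (q t) (L1 (q t)) - dot (D (s t)) (q t)
     + al) <= - c1 * (al + S + Q).
  set X := (X in eps * X).
  have X_le : X <= M * (al + S) - mu / 2 * Q.
    have M1 : 0 <= (d / mu) * al by rewrite mulr_ge0// ltW// divr_gt0.
    have M2 : 0 <= (4 / mu * k1) * S by rewrite mulr_ge0// ltW// mulr_gt0// divr_gt0.
    rewrite /X /M; lra.
  have : eps * X <= al + S - eps * (mu / 2) * Q.
    have -> : al + S - eps * (mu / 2) * Q = eps * (M * (al + S) - mu / 2 * Q).
      by rewrite mulrBr [eps * (M * _)]mulrA epsM mul1r [eps * (_ * Q)]mulrA.
    by rewrite ler_pM2l.
  have : c1 * (al + S) <= al + S by rewrite ler_piMl// addr_ge0.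
  have : c1 * Q <= eps * (mu / 2) * Q by rewrite ler_wpM2r.
  rewrite /dV -/al -/S; lra.
apply: (le_trans dissip); rewrite !mulNr lerN2 -mulrA ler_pM2l//.
rewrite mulrC ler_pdivrMr; last lra.
have V_le : V t <= (C + 1) * (al + S + Q).
  have := @hC (x t) (y t) (z t) (a t) (s t) erefl erefl.
  rewrite -/al -/S -/Q /V -/Q; lra.
have : 0 <= (C + 1) * (al + S + Q) by rewrite mulr_ge0 ?addr_ge0// ltW.
have := eaqV t; rewrite ler_norml => /andP[_]; lra.
Qed.

Lemma closed_loop_decay : exists K alpha : R, [/\ 0 <= K, 0 < alpha &
  forall t, 0 <= t -> V t <= K * expR (- alpha * t)].
Proof.
have [eps [c [c0 V_le dW]]] := lyapunov.
pose W t := V t + eps * dot (a t) (q t).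
have W_derive (t : R) : 0 <= t -> is_derive t 1 W _ :=
  fun t0 => is_deriveD (V_derive t0) (is_derive_scale eps (aq_derive t0)).
have V_ge0 t : 0 <= V t by have [+ _ _] := V_ge t; exact: le_trans (dot_ge0 _).
exists (2 * W 0), c; split => // [|t t0].
  exact: le_trans (V_ge0 0) (V_le 0).
apply: (le_trans (V_le t)); rewrite -mulrA ler_pM2l//.
exact: (gronwall W_derive (fun t _ => dW t) t0).
Qed.

(** The squared norms of x' = a and y' = s are bounded by multiples of V, so both velocities decay
    exponentially and are integrable in time. The limits lie in the kernels because L1 x = q and L2
    y are controlled by V as well. *)
Theorem closed_loop_converges : exists xl yl : U,
  [/\ forall p, converges_exponentially (fun t => x t p) (xl p),
      forall p, converges_exponentially (fun t => y t p) (yl p),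
      L1 xl = 0, L2 yl = 0 &
      forall p, a t p @[t --> +oo] --> (0 : R)].
Proof.
have [K [alpha [K0 alpha0 V_le]]] := closed_loop_decay.
have small (f : R -> U) (k : R) : 0 <= k ->
    (forall t, dot (f t) (f t) <= k * V t) -> exists2 C : R, 0 <= C &
    forall p t, 0 <= t -> `|f t p : R| <= C * expR (- (alpha / 2) * t).
  move=> k0 fV; exists (Num.sqrt (k * K)) => [|p t t0]; first exact: sqrtr_ge0.
  apply: sqr_le_expR; first exact: mulr_ge0.
  rewrite -mulrA (le_trans (sqr_le_dot (f t) p))// (le_trans (fV t))//.
  by rewrite ler_wpM2l// V_le.
have alpha2 : 0 < alpha / 2 by rewrite divr_gt0.
have to0 (f : R -> U) (k : R) : 0 <= k ->
    (forall t, dot (f t) (f t) <= k * V t) ->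
    forall p, f t p @[t --> +oo] --> (0 : R).
  move=> k0 /(small _ _ k0)[C C0 fC] p; apply: converges_exponentially_cvg.
  by exists C, (alpha / 2); split => // t t0; rewrite subr0 fC.
have conv (u f : R -> U) (k : R) : 0 <= k ->
    (forall t, dot (f t) (f t) <= k * V t) ->
    (forall t : R, 0 <= t -> vderive u f t) ->
    exists ul : U, forall p, converges_exponentially (fun t => u t p) (ul p).
  move=> k0 /(small _ _ k0)[C C0 fC] uf.
  have /choice[l hl] p : exists l, converges_exponentially (fun t => u t p) l.
    apply: (derive_exp_bound_converges (df := fun t => f t p) C0 alpha2).
      by move=> t t0; exact: uf.
    exact: fC.
  by exists [ffun p => l p] => p; rewrite ffunE.
have aV t : dot (a t) (a t) <= 1 * V t by rewrite mul1r; have [] := V_ge t.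
have qV t : dot (q t) (q t) <= 1 * V t by rewrite mul1r; have [] := V_ge t.
have L2yV t : dot (L2 (y t)) (L2 (y t)) <= k2 * V t.
  by rewrite (le_trans (L2k _))// ler_pM2l//; have [] := V_ge t.
have [d d_gt0 hD] := linear_bounded D.
(* |s|^2 is not a summand of V; it is bounded by 2 |D a|^2 + 2 |L2 y|^2, whose terms are controlled
   by |a|^2 and <y, L2 y>. *)
have sV t : dot (s t) (s t) <= (2 * d + 2 * k2) * V t.
  have -> : dot (s t) (s t) = dot (D (a t)) (D (a t)) + dot (L2 (y t)) (L2 (y t))
      - 2 * dot (D (a t)) (L2 (y t)).
    rewrite {1}/s dotBl (dotC _ (s t)) [X in _ - X = _]dotC /s !dotBl.
    by rewrite (dotC (L2 (y t)) (D (a t))); ring.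
  have := young (D (a t)) (L2 (y t)) ltr01; rewrite ler_norml invr1 => /andP[+ _].
  have : d * dot (a t) (a t) <= d * (1 * V t) by rewrite ler_pM2l.
  by have := hD (a t); have := L2yV t; lra.
have [xl hxl] := conv _ _ _ ler01 aV dx.
have [|yl hyl] := conv _ _ _ _ sV dy; first by rewrite addr_ge0// mulr_ge0// ltW.
exists xl, yl; split => //; last exact: to0 ler01 aV.
- apply/ffunP => p; rewrite [RHS]ffunE.
  apply: (cvg_unique (@norm_hausdorff R R) (F := L1 (x t) p @[t --> +oo]));
    last exact: to0 ler01 qV p.
  apply: (@cvg_linear _ _ L1 x xl (pinfty_nbhs R) _) => r.
  exact: converges_exponentially_cvg.
- apply/ffunP => p; rewrite [RHS]ffunE.
  apply: (cvg_unique (@norm_hausdorff R R) (F := L2 (y t) p @[t --> +oo])).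
    apply: (@cvg_linear _ _ L2 y yl (pinfty_nbhs R) _) => r.
    exact: converges_exponentially_cvg.
  exact: to0 (ltW k2_gt0) L2yV p.
Qed.

End closed_loop.

(** * Graph Laplacians on the grid of agents *)

Section laplacian.
Variables (R : realFieldType) (T : finType) (E : rel T).
Hypothesis Esym : symmetric E.
Local Notation U := {ffun T -> R^o}.

Definition laplacian (u : U) : U := [ffun p => \sum_(r | E p r) (u p - u r)].

Lemma laplacian_linear : linear laplacian.
Proof.
move=> c u v; apply/ffunP => p; rewrite !ffunE /GRing.scale /= big_distrr /=.
by rewrite -big_split; apply: eq_bigr => r _; rewrite !ffunE /GRing.scale /=; ring.
Qed.

HB.instance Definition _ :=
  GRing.isLinear.Build _ _ _ _ laplacian laplacian_linear.

(** Swapping the endpoints of each ordered edge and averaging gives the Dirichlet form; the factor 2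
    appears because every undirected edge is counted in both directions. *)
Lemma dot_laplacian (u v : U) : 2 * dot v (laplacian u) =
  \sum_p \sum_(r | E p r) (v p - v r) * (u p - u r).
Proof.
have dotE : dot v (laplacian u) = \sum_p \sum_(r | E p r) v p * (u p - u r).
  by apply: eq_bigr => p _; rewrite ffunE big_distrr.
have dotE' : dot v (laplacian u) = \sum_p \sum_(r | E p r) v r * (u r - u p).
  rewrite dotE (exchange_big_dep xpredT)//=.
  by apply: eq_bigr => p _; apply: eq_bigl => r; rewrite Esym.
rewrite mulr2n mulrDl mul1r {1}dotE dotE' -big_split; apply: eq_bigr => p _.
by rewrite -big_split; apply: eq_bigr => r _ /=; ring.
Qed.

Lemma laplacian_self_adjoint : self_adjoint laplacian.
Proof.
move=> u v; apply: (@mulfI _ 2); first by rewrite pnatr_eq0.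
rewrite dotC !dot_laplacian; apply: eq_bigr => p _; apply: eq_bigr => r _.
by rewrite mulrC.
Qed.

(** Cauchy-Schwarz on each vertex sum, which has at most [#|T|] terms, bounds the left side by
    [#|T|] times the Dirichlet energy, itself 2 <u, L u>. The added 1 keeps the constant positive
    even for empty [T]. *)
Lemma laplacian_bound (u : U) :
  dot (laplacian u) (laplacian u) <=
  (2 * #|T|%:R + 1) * dot u (laplacian u).
Proof.
have sqr_sum p : laplacian u p ^+ 2 <=
    #|T|%:R * \sum_(r | E p r) (u p - u r) * (u p - u r).
  pose w r := if E p r then u p - u r : R else 0.
  have -> : laplacian u p = dot w (fun=> 1).
    rewrite ffunE big_mkcond; apply: eq_bigr => r _; rewrite mulr1 /w.
    by case: ifP.
  have -> : \sum_(r | E p r) (u p - u r) * (u p - u r) = dot w w.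
    rewrite big_mkcond; apply: eq_bigr => r _; rewrite /w.
    by case: ifP; rewrite ?mulr0.
  apply: (le_trans (cauchy_schwarz _ _)); rewrite mulrC.
  by rewrite /dot mulr1 sumr_const.
have energy_ge0 : 0 <= dot u (laplacian u).
  rewrite -(@pmulr_rge0 _ 2)// dot_laplacian; apply: sumr_ge0 => p _.
  by apply: sumr_ge0 => r _; rewrite -expr2 sqr_ge0.
have : dot (laplacian u) (laplacian u) <= #|T|%:R * (2 * dot u (laplacian u)).
  by rewrite dot_laplacian mulr_sumr; apply: ler_sum => p _; rewrite -expr2.
lra.
Qed.

(** A vanishing Laplacian makes the Dirichlet energy, a sum of squares over edges, equal to zero. *)
Lemma laplacian_eq0P (u : U) :
  laplacian u = 0 <-> forall p r, E p r -> u p = u r.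
Proof.
split=> [u0 p r Epr|uE]; last first.
  apply/ffunP => p; rewrite !ffunE big1// => r Epr.
  by rewrite (uE p r)// subrr.
have : 2 * dot u (laplacian u) = 0 by rewrite u0 dotC dot0l mulr0.
rewrite dot_laplacian => /eqP; rewrite psumr_eq0 => [|i _]; last first.
  by apply: sumr_ge0 => j _; rewrite -expr2 sqr_ge0.
move=> /allP /(_ p (mem_index_enum p)) /=.
rewrite psumr_eq0 => [|j _]; last by rewrite -expr2 sqr_ge0.
move=> /allP /(_ r (mem_index_enum r)); rewrite Epr /= mulf_eq0 orbb subr_eq0.
by move=> /eqP.
Qed.

Lemma dot_laplacian_const (u v : U) : (forall p r, E p r -> v p = v r) ->
  dot (laplacian u) v = 0.
Proof. by move=> /laplacian_eq0P v0; rewrite laplacian_self_adjoint v0 dotC dot0l. Qed.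

End laplacian.

Lemma connect_const (V : finType) (S : Type) (E : rel V) (f : V -> S) :
  (forall u v, E u v -> f u = f v) -> forall u v, connect E u v -> f u = f v.
Proof.
move=> fE u v /connectP[s]; elim: s u => [u _ ->//|w s ih u] /= /andP[Euw ws] vE.
by rewrite (fE _ _ Euw); exact: ih.
Qed.

Section diagonal.
Variables (R : realFieldType) (T : finType) (d : T -> R).
Local Notation U := {ffun T -> R^o}.

Definition diagonal (u : U) : U := [ffun p => d p * u p].

Lemma diagonal_linear : linear diagonal.
Proof.
by move=> c u v; apply/ffunP => p; rewrite !ffunE /GRing.scale /=; ring.
Qed.

HB.instance Definition _ :=
  GRing.isLinear.Build _ _ _ _ diagonal diagonal_linear.

Lemma diagonal_self_adjoint : self_adjoint diagonal.
Proof. by move=> u v; apply: eq_bigr => p _; rewrite !ffunE; ring. Qed.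

End diagonal.

(** * Row and column graphs as graphs on the whole grid *)

Section product_graphs.
Variables (m n : nat).
Local Notation T := ('I_m * 'I_n)%type.

(** The disjoint union of the row graphs: one Laplacian on the grid then acts along all rows at
    once, and its kernel consists of the functions constant on each row when the row graphs are
    connected. *)
Definition row_edge (GR : 'I_m -> rel 'I_n) : rel T :=
  fun p r => (p.1 == r.1) && GR p.1 p.2 r.2.

Definition column_edge (Gc : 'I_n -> rel 'I_m) : rel T :=
  fun p r => (p.2 == r.2) && Gc p.2 p.1 r.1.

Lemma row_edge_sym GR : (forall i, symmetric (GR i)) -> symmetric (row_edge GR).
Proof.
move=> sG [i j] [k l]; rewrite /row_edge/= eq_sym.
by case: eqP => //= ->; exact: sG.
Qed.

Lemma column_edge_sym Gc : (forall j, symmetric (Gc j)) -> symmetric (column_edge Gc).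
Proof.
move=> sG [i j] [k l]; rewrite /column_edge/= eq_sym.
by case: eqP => //= ->; exact: sG.
Qed.

Lemma sum_row_edge (V : nmodType) GR i j (F : T -> V) :
  \sum_(r | row_edge GR (i, j) r) F r = \sum_(k | GR i j k) F (i, k).
Proof.
pose G k l := if row_edge GR (i, j) (k, l) then F (k, l) else 0.
rewrite big_mkcond (eq_bigr (fun r => G r.1 r.2)) => [|[]//].
rewrite -(pair_bigA _ G) /G/=.
rewrite (bigD1 i)//= [X in _ + X]big1 ?addr0 => [|k ki].
  by rewrite -big_mkcond; apply: eq_bigl => l; rewrite /row_edge/= eqxx.
by rewrite big1// => l _; rewrite /row_edge/= eq_sym (negbTE ki).
Qed.

Lemma sum_column_edge (V : nmodType) Gc i j (F : T -> V) :
  \sum_(r | column_edge Gc (i, j) r) F r = \sum_(k | Gc j i k) F (k, j).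
Proof.
pose G k l := if column_edge Gc (i, j) (k, l) then F (k, l) else 0.
rewrite big_mkcond (eq_bigr (fun r => G r.1 r.2)) => [|[]//].
rewrite -(pair_bigA _ G) /G/=.
rewrite [RHS]big_mkcond; apply: eq_bigr => k _.
rewrite (bigD1 j)//= big1 ?addr0 => [|l lj].
  by rewrite /column_edge/= eqxx.
by rewrite /column_edge/= eq_sym (negbTE lj).
Qed.

Lemma row_edge_const (S : Type) GR (f : T -> S) :
  (forall i, connected_graph (GR i)) ->
  (forall p r, row_edge GR p r -> f p = f r) ->
  forall i j l, f (i, j) = f (i, l).
Proof.
move=> cG fE i j l; apply: (connect_const (f := fun j => f (i, j))) (cG i j l).
by move=> u v uv; apply: fE; rewrite /row_edge/= eqxx.
Qed.

Lemma column_edge_const (S : Type) Gc (f : T -> S) :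
  (forall j, connected_graph (Gc j)) ->
  (forall p r, column_edge Gc p r -> f p = f r) ->
  forall i k j, f (i, j) = f (k, j).
Proof.
move=> cG fE i k j; apply: (connect_const (f := fun i => f (i, j))) (cG j i k).
by move=> u v uv; apply: fE; rewrite /column_edge/= eqxx.
Qed.

End product_graphs.

(** * Normal equations, conserved quantities and limits *)

(** Pythagoras: the residual at [x] is orthogonal to the range of [A], so any other [w] adds |A (w -
    x)|^2 to its squared norm. *)
Lemma normal_equation_least_square (R : realType) m n (A : 'M[R]_(m, n))
    (b : 'cV[R]_m) (x : 'cV[R]_n) :
  (forall j, \sum_i A i j * (A *m x - b) i 0 = 0) -> least_square_solution A b x.
Proof.
move=> normal w; rewrite /norm2 !sqr_sqrtr; do ?by apply: sumr_ge0 => i _; exact: sqr_ge0.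
have -> : A *m w - b = (A *m x - b) + A *m (w - x).
  by rewrite mulmxBr; apply/matrixP => i j; rewrite !mxE; ring.
set r := A *m x - b; set e := w - x.
have ortho : \sum_i r i 0 * (A *m e) i 0 = 0.
  under eq_bigr do rewrite [in X in _ * X]mxE big_distrr /=.
  rewrite exchange_big big1//= => j _.
  transitivity ((\sum_i A i j * r i 0) * e j 0); last by rewrite normal mul0r.
  rewrite big_distrl /=.
  by apply: eq_bigr => i _; ring.
have -> : \sum_i (r + A *m e) i 0 ^+ 2 =
    \sum_i r i 0 ^+ 2 + 2 * (\sum_i r i 0 * (A *m e) i 0) + \sum_i (A *m e) i 0 ^+ 2.
  rewrite big_distrr -!big_split; apply: eq_bigr => i _ /=; rewrite mxE; ring.
by rewrite ortho mulr0 addr0 lerDl; apply: sumr_ge0 => i _; exact: sqr_ge0.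
Qed.

Lemma vderive_extension (R : realType) (T : finType) (f df : T -> R -> R) :
  (forall p t, 0 <= t -> has_time_derivative (f p) t (df p t)) ->
  exists F : R -> {ffun T -> R^o}, forall t : R, 0 <= t ->
    (forall p, F t p = f p t) /\ vderive F (fun t => [ffun p => df p t]) t.
Proof.
move=> fdf.
have /choice[g hg] p := has_time_derivative_extension (fdf p).
exists (fun t => [ffun p => g p t]) => t t0; split=> p.
  by rewrite ffunE; have [] := hg p t t0.
have -> : (fun t => [ffun p => g p t] p : R) = g p.
  by apply/funext => s; rewrite ffunE.
by rewrite ffunE; have [] := hg p t t0.
Qed.

Lemma cvg_dot (R : realType) (T : finType) (u : R -> {ffun T -> R^o})
    (l : {ffun T -> R^o}) (c : T -> R) (F : set_system R) {FF : Filter F} :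
  (forall p, u t p @[t --> F] --> (l p : R)) ->
  dot (u t) c @[t --> F] --> dot l c.
Proof.
move=> ul; apply: cvg_big => [|q _]; first exact: add_continuous.
by apply: cvgM; [exact: ul|exact: cvg_cst].
Qed.

(** Both the pairing with [c] and its opposite are nonincreasing. *)
Lemma vderive_dot_const (R : realType) (T : finType)
    (u du : R -> {ffun T -> R^o}) (c : {ffun T -> R^o}) :
  (forall t : R, 0 <= t -> vderive u du t) ->
  (forall t : R, 0 <= t -> dot (du t) c = 0) ->
  forall t : R, 0 <= t -> dot (u t) c = dot (u 0) c.
Proof.
move=> udu duc t t0.
have duc' (s : R) : 0 <= s -> is_derive s 1 (fun s => dot (u s) c) 0.
  move=> s0; apply: is_derive_eq (is_derive_dot (udu s s0) (vderive_cst c s)) _.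
  by rewrite duc// dotC dot0l addr0.
have dNuc (s : R) : 0 <= s -> is_derive s 1 (fun s => - dot (u s) c) 0.
  by move=> s0; rewrite -oppr0; apply: is_deriveN; exact: duc'.
apply/eqP; rewrite eq_le (is_derive_ge0_nincr (df := fun=> 0) duc' _ (lexx 0) t0)//=.
by rewrite -lerN2 (is_derive_ge0_nincr (df := fun=> 0) dNuc _ (lexx 0) t0).
Qed.

Lemma converges_exponentially_eq (R : realType) (f g : R -> R) (l : R) :
  (forall t : R, 0 <= t -> f t = g t) ->
  converges_exponentially f l -> converges_exponentially g l.
Proof.
move=> fg [C [alpha [C0 a0 fl]]]; exists C, alpha; split => // t t0.
by rewrite -fg// fl.
Qed.

Lemma cvg_pinfty_unique (R : realType) (f g : R -> R) (k l : R) :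
  (forall t : R, 0 <= t -> f t = g t) ->
  f t @[t --> +oo] --> k -> g t @[t --> +oo] --> l -> k = l.
Proof.
move=> fg fk gl; apply: (cvg_unique (@norm_hausdorff R R) (F := g t @[t --> +oo])) => //.
apply: cvg_trans fk; apply: near_eq_cvg; near=> t; apply: fg.
by near: t; exact: nbhs_pinfty_ge.
Unshelve. all: by end_near. Qed.

(** * Convergence of the distributed dynamics to a least square solution *)

Theorem theorem1 (R : realType) (m n : nat)
    (A : 'M[R]_(m, n)) (b : 'cV[R]_m) (B : 'M[R]_(m, n))
    (GR : 'I_m -> rel 'I_n) (Gc : 'I_n -> rel 'I_m)
    (x xi z y : 'I_m -> 'I_n -> R -> R)
    (hB : forall i, b i 0 = \sum_(j < n) B i j)
    (hGR : forall i, undirected_graph (GR i) /\ connected_graph (GR i))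
    (hGc : forall j, undirected_graph (Gc j) /\ connected_graph (Gc j))
    (hx : forall i j t, 0 <= t ->
      has_time_derivative (x i j) t
        (- (A i j * y i j t - \sum_(k < m | Gc j i k) (z i j t - z k j t))
         - \sum_(k < m | Gc j i k) (x i j t - x k j t)))
    (hxi : forall i j t, 0 <= t ->
      has_time_derivative (xi i j) t
        (- \sum_(k < n | GR i j k) (y i j t - y i k t)))
    (hy : forall i j t, 0 <= t ->
      y i j t = xi i j t + A i j * x i j t - B i j)
    (hz : forall i j t, 0 <= t ->
      has_time_derivative (z i j) t
        (A i j * y i j t - \sum_(k < m | Gc j i k) (z i j t - z k j t)))
    (hxi0 : forall i j, xi i j 0 = 0) :
  exists xlim : 'M[R]_(m, n),
    (forall i j, converges_exponentially (x i j) (xlim i j)) /\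
    exists xstar : 'cV[R]_n,
      [/\ forall i j, xlim i j = xstar j 0,
          forall j, \sum_(i < m) A i j *
                      (\sum_(k < n) (A i k * xstar k 0 - B i k)) = 0,
          least_square_solution A b xstar &
          A *m xstar = b <-> forall i j, y i j t @[t --> +oo] --> (0 : R)].
Proof.
set T := ('I_m * 'I_n)%type; pose U := {ffun T -> R^o}.
pose Ec := column_edge Gc; pose Er := row_edge GR.
have Ec_sym : symmetric Ec := column_edge_sym (fun j => (hGc j).1).
have Er_sym : symmetric Er := row_edge_sym (fun i => (hGR i).1).
pose L1 : {linear U -> U} := laplacian Ec.
pose L2 : {linear U -> U} := laplacian Er.
pose D : {linear U -> U} := diagonal (fun p : T => A p.1 p.2).
pose Bv : U := [ffun p => B p.1 p.2].
have [X hX] := vderive_extension (fun (p : T) => hx p.1 p.2).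
have [XI hXI] := vderive_extension (fun (p : T) => hxi p.1 p.2).
have [Z hZ] := vderive_extension (fun (p : T) => hz p.1 p.2).
(* The relation for y is known only for t >= 0. [Y] is built from the extended signals, so that it
   is differentiable also at 0, and agrees with y from time 0 on. *)
pose Y t : U := XI t + D (X t) - Bv.
have YE i j (t : R) : 0 <= t -> Y t (i, j) = y i j t.
  by move=> t0; rewrite !ffunE (hXI t t0).1 (hX t t0).1 hy.
have L1X i j (t : R) : 0 <= t ->
    L1 (X t) (i, j) = \sum_(k | Gc j i k) (x i j t - x k j t).
  move=> t0; rewrite ffunE (sum_column_edge Gc i j (fun r => X t (i, j) - X t r)).
  by apply: eq_bigr => k _; rewrite !(hX t t0).1.
have L1Z i j (t : R) : 0 <= t ->
    L1 (Z t) (i, j) = \sum_(k | Gc j i k) (z i j t - z k j t).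
  move=> t0; rewrite ffunE (sum_column_edge Gc i j (fun r => Z t (i, j) - Z t r)).
  by apply: eq_bigr => k _; rewrite !(hZ t t0).1.
have L2Y i j (t : R) : 0 <= t ->
    L2 (Y t) (i, j) = \sum_(k | GR i j k) (y i j t - y i k t).
  move=> t0; rewrite ffunE (sum_row_edge GR i j (fun r => Y t (i, j) - Y t r)).
  by apply: eq_bigr => k _; rewrite !YE.
pose a t := L1 (Z t) - D (Y t) - L1 (X t).
have vE (F : R -> U) (f g : R -> U) (t : R) :
    vderive F f t -> (forall i j, f t (i, j) = g t (i, j)) -> vderive F g t.
  by move=> Ff fg [i j]; rewrite -fg; exact: Ff.
have subE (u v : U) p : (u - v) p = (u p : R) - v p by rewrite !ffunE.
have oppE (u : U) p : (- u) p = - (u p : R) by rewrite ffunE.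
have DE (u : U) i j : D u (i, j) = A i j * u (i, j) by rewrite ffunE.
have dX (t : R) : 0 <= t -> vderive X a t.
  move=> t0; apply: vE (hX t t0).2 _ => i j; rewrite [LHS]ffunE /=.
  by rewrite /a !subE DE L1Z// L1X// YE// opprB.
have dZ (t : R) : 0 <= t -> vderive Z (fun t => D (Y t) - L1 (Z t)) t.
  move=> t0; apply: vE (hZ t t0).2 _ => i j; rewrite [LHS]ffunE /=.
  by rewrite subE DE L1Z// YE.
have dXI (t : R) : 0 <= t -> vderive XI (fun t => - L2 (Y t)) t.
  move=> t0; apply: vE (hXI t t0).2 _ => i j; rewrite [LHS]ffunE /=.
  by rewrite oppE L2Y.
have dY (t : R) : 0 <= t -> vderive Y (fun t => D (a t) - L2 (Y t)) t.
  move=> t0.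
  (* [Y] is regrouped as XI - (Bv - D X), so that the rule for differences suffices. *)
  have dNDX := vderiveB (vderive_cst Bv t) (vderive_linear D (dX t t0)).
  have := vderiveB (dXI t t0) dNDX.
  have -> : (fun t => XI t - (Bv - D (X t))) = Y.
    by apply/funext => s; rewrite /Y opprB addrA.
  by move=> /vE; apply=> i j; rewrite sub0r opprK addrC.
have k_gt0 : 0 < 2 * #|{: T}|%:R + 1 :> R by rewrite ltr_wpDl// mulr_ge0.
have [xl [yl [hxl hyl L1xl L2yl a0]]] := closed_loop_converges
  (laplacian_self_adjoint Ec_sym) (laplacian_self_adjoint Er_sym)
  (diagonal_self_adjoint _) k_gt0 k_gt0 (laplacian_bound Ec_sym)
  (laplacian_bound Er_sym) dX dY dZ.
have xl_const := column_edge_const (fun j => (hGc j).2)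
  ((laplacian_eq0P Ec_sym xl).1 L1xl).
have yl_const := row_edge_const (fun i => (hGR i).2)
  ((laplacian_eq0P Er_sym yl).1 L2yl).
exists (\matrix_(i, j) xl (i, j)); split=> [i j|].
  rewrite mxE; apply: converges_exponentially_eq (hxl (i, j)) => t t0.
  by rewrite (hX t t0).1.
(* Any row may represent a column, since [xl] is constant along columns; the default 0 is taken only
   when m = 0. *)
pose xstar : 'cV[R]_n :=
  \col_j (if [pick i : 'I_m] is Some i then xl (i, j) else 0).
have xstarE i j : xl (i, j) = xstar j 0.
  by rewrite mxE; case: pickP => [k _|/(_ i)//]; exact: xl_const.
pose residual i := \sum_(k < n) (A i k * xstar k 0 - B i k).
have residualE i : (A *m xstar - b) i 0 = residual i.
  by rewrite !mxE hB -sumrB.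
(* Summed over a row, the xi_ij keep their initial value 0. *)
have residual_yl i : residual i = \sum_(k < n) yl (i, k).
  (* Row sums are pairings with the indicator of row [i], which the row Laplacian annihilates. *)
  pose row : U := [ffun p => (p.1 == i)%:R].
  have dot_row (u : U) : dot u row = \sum_k u (i, k).
    rewrite /dot (eq_bigr (fun p => u (p.1, p.2) * (p.1 == i)%:R)) => [|[k j] _].
      rewrite -(pair_bigA _ (fun k j => u (k, j) * (k == i)%:R)) /= (bigD1 i)//=.
      rewrite [X in _ + X]big1 => [|k /negbTE ki].
        by rewrite addr0; apply: eq_bigr => j _; rewrite eqxx mulr1.
      by rewrite big1// => j _; rewrite ki mulr0.
    by rewrite ffunE.
  have row_const p r : Er p r -> row p = row r.
    by rewrite !ffunE => /andP[/eqP -> _].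
  have XI_row (t : R) : 0 <= t -> dot (XI t) row = 0.
    move=> t0; rewrite (vderive_dot_const dXI)// => [|s s0].
      by rewrite dot_row big1// => k _; rewrite (hXI 0 (lexx 0)).1.
    by rewrite dotNl dot_laplacian_const ?oppr0.
  have X_cvg p : X t p @[t --> +oo] --> (xl p : R).
    exact: converges_exponentially_cvg.
  have Y_cvg p : Y t p @[t --> +oo] --> (yl p : R).
    exact: converges_exponentially_cvg.
  have Y_row (t : R) : 0 <= t -> dot (D (X t)) row - dot Bv row = dot (Y t) row.
    by move=> t0; rewrite dotBl dotDl XI_row// add0r.
  have -> : residual i = dot (D xl) row - dot Bv row.
    rewrite !dot_row -sumrB; apply: eq_bigr => k _.
    by rewrite DE xstarE ffunE.
  rewrite -dot_row; apply: (cvg_pinfty_unique Y_row).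
    apply: cvgB; last exact: cvg_cst.
    apply: (@cvg_dot _ _ (fun t => D (X t)) (D xl) row (pinfty_nbhs R) _).
    exact: (@cvg_linear _ _ D X xl (pinfty_nbhs R) _).
  exact: (@cvg_dot _ _ Y yl row (pinfty_nbhs R) _).
(* By consensus along the row, the residual is shared equally among its n agents. *)
have residual_ylE i j : residual i = n%:R * yl (i, j).
  rewrite residual_yl (eq_bigr (fun=> yl (i, j))) => [|k _]; last exact: yl_const.
  by rewrite sumr_const card_ord mulr_natl.
(* Summed over a column, the Laplacian terms of the x_ij' cancel. *)
have A_yl j : \sum_i A i j * yl (i, j) = 0.
  pose col : U := [ffun p => (p.2 == j)%:R].
  have dot_col (u : U) : dot u col = \sum_i u (i, j).
    rewrite /dot (eq_bigr (fun p => u (p.1, p.2) * (p.2 == j)%:R)) => [|[k l] _].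
      rewrite -(pair_bigA _ (fun k l => u (k, l) * (l == j)%:R)) /=.
      apply: eq_bigr => k _; rewrite (bigD1 j)//= eqxx mulr1 big1 ?addr0//.
      by move=> l /negbTE ->; rewrite mulr0.
    by rewrite ffunE.
  have col_const p r : Ec p r -> col p = col r.
    by rewrite !ffunE => /andP[/eqP -> _].
  have a_col (t : R) : 0 <= t -> dot (D (Y t)) col = - dot (a t) col.
    move=> _; rewrite /a !dotBl !dot_laplacian_const//.
    by rewrite subr0 sub0r opprK.
  transitivity (dot (D yl) col).
    by rewrite dot_col; apply: eq_bigr => i _; rewrite DE.
  rewrite -[RHS]oppr0 -(dot0l col); apply: (cvg_pinfty_unique a_col).
    apply: (@cvg_dot _ _ (fun t => D (Y t)) (D yl) col (pinfty_nbhs R) _).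
    apply: (@cvg_linear _ _ D Y yl (pinfty_nbhs R) _) => p.
    exact: converges_exponentially_cvg.
  apply: cvgN; apply: (@cvg_dot _ _ a 0 col (pinfty_nbhs R) _) => p.
  by rewrite ffunE; exact: a0.
(* Multiplying the column identity [A_yl] by n replaces each limit of y by the residual of its
   row. *)
have normal j : \sum_i A i j * residual i = 0.
  under eq_bigr do rewrite (residual_ylE _ j) mulrCA.
  by rewrite -big_distrr /= A_yl mulr0.
have y_cvg i j : y i j t @[t --> +oo] --> (yl (i, j) : R).
  apply: converges_exponentially_cvg.
  by apply: converges_exponentially_eq (hyl (i, j)) => t t0; exact: YE.
exists xstar; split => //; first by move=> i j; rewrite mxE.
  apply: normal_equation_least_square => j.
  by under eq_bigr do rewrite residualE.
split=> [Ax i j|y0].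
  have /eqP : n%:R * (yl (i, j) : R) = 0.
    by rewrite -residual_ylE -residualE Ax subrr mxE.
  (* The index [j] itself witnesses that n is nonzero, so n can be cancelled. *)
  have /negbTE n0 : n != 0%N by rewrite -lt0n (leq_ltn_trans (leq0n _) (ltn_ord j)).
  rewrite mulf_eq0 pnatr_eq0 n0 /=.
  by move=> /eqP yl0; rewrite -yl0.
apply/eqP; rewrite -subr_eq0; apply/eqP/matrixP => i k; rewrite (ord1 k) residualE mxE.
(* The row-sum form of the residual is used here, which covers n = 0 as an empty sum. *)
rewrite residual_yl big1// => j _.
exact: cvg_pinfty_unique (fun=> _) (y_cvg i j) (y0 i j).
Qed.
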